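(* Suppose the model satisfies the following conditions: (i) $\hat\theta^{ML}-\theta=O_p(n^{-1/2})$; (ii) $\ell_n(\theta)=O_p(n)$; (iii) $\ell_n(\theta)$ is three times continuously differentiable; (iv) the prior density $\pi(\theta)$ is differentiable; (v) $H_n(\theta)$ is invertible and $H_n(\hat\theta^{ML})$ is positive definite. Suppose moreover that: (a) there exists a non-singular $p\times p$ constant matrix $H(\theta)$ with $H_n(\theta)=H(\theta)+O_p(n^{-1/2})$, and consequently $H_n^{-1}(\theta)=H^{-1}(\theta)+O_p(n^{-1/2})$; (b) for each $r,s,t=1,\ldots,p$ there exists a constant $K_{rst}(\theta)$ with $K_{n,rst}(\theta)=K_{rst}(\theta)+o_p(1)$; (c) there exists a $p\times p$ matrix $I(\theta)$ with $E\{I_n(\theta)\}=I(\theta)+o(1)$; (d) for each $r,s,t=1,\ldots,p$ there exists $J_{rs,t}(\theta)$ with $E\{J_{n,rs,t}(\theta)\}=J_{rs,t}(\theta)+o(1)$. Then the bias of the Bayes estimator is $$E(\hat\theta^{B})-\theta=n^{-1}H^{-1}(\theta)\left\{\frac{\partial\log\pi(\theta)}{\partial\theta}+\frac12\sum_{r=1}^p\sum_{s=1}^pH^{rs}(\theta)A_{rs}(\theta)\right\}+o(n^{-1}),$$ where, for $r,s=1,\ldots,p$, $A_{rs}(\theta)$ is the $p$-dimensional vector with elements $$A_{rsv}(\theta)=K_{vrs}(\theta)+2J_{vr,s}(\theta)+\sum_{t=1}^p\sum_{u=1}^pH^{tu}(\theta)I_{su}(\theta)K_{rtv}(\theta)\quad(v=1,\ldots,p).$$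 This implies that the Bayes estimator is second-order unbiased, i.e. $E(\hat\theta^B)-\theta=o(n^{-1})$, if the prior $\pi(\theta)$ satisfies $$\frac{\partial\log\pi(\theta)}{\partial\theta}=-\frac12\sum_{r=1}^p\sum_{s=1}^pH^{rs}(\theta)A_{rs}(\theta).$$
   Context: $X_1,\ldots,X_n$ have joint density $f_n(x_1,\ldots,x_n\mid\theta)$, where the true parameter $\theta$ is an interior point of the parameter space $\Theta$, a rectangular subspace of $\mathbb{R}^p$. The asymptotics are as $n\to\infty$; $O_p,o_p$ and the expectation $E$ are with respect to the distribution with parameter $\theta$. The log-likelihood is $\ell_n(\theta)=\log f_n(X_1,\ldots,X_n\mid\theta)$. The maximum likelihood estimator $\hat\theta^{ML}$ solves $\partial\ell_n(\theta)/\partial\theta|_{\theta=\hat\theta^{ML}}=0$. For a prior density $\pi$ on $\Theta$ (possibly improper), the (generalized) Bayes estimator is the posterior mean $$\hat\theta^{B}=\frac{\int_\Theta\theta\,\pi(\theta)\exp\{\ell_n(\theta)\}\,d\theta}{\int_\Theta\pi(\theta)\exp\{\ell_n(\theta)\}\,d\theta}.$$ Define $$H_n(\theta)=-n^{-1}\frac{\partial^2\ell_n(\theta)}{\partial\theta\,\partial\theta^{\mathrm T}},\quad I_{n,rs}(\theta)=n^{-1}\frac{\partial\ell_n(\theta)}{\partial\theta_r}\frac{\partial\ell_n(\theta)}{\partial\theta_s},\quad J_{n,rs,t}(\theta)=n^{-1}\frac{\partial^2\ell_n(\theta)}{\partial\theta_r\partial\theta_s}\frac{\partial\ell_n(\theta)}{\partial\theta_t},\quad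 K_{n,rst}(\theta)=n^{-1}\frac{\partial^3\ell_n(\theta)}{\partial\theta_r\partial\theta_s\partial\theta_t}.$$ $I_n(\theta)$ is the $p\times p$ matrix with entries $I_{n,rs}(\theta)$. For a matrix $M$, $M_{rs}$ is its $(r,s)$ entry and $M^{rs}$ is the $(r,s)$ entry of its inverse $M^{-1}$ (if it exists). Standing assumption: under (i)-(v) the Bayes estimator has the expansion $$\hat\theta^{B}=\theta+n^{-1}H_n^{-1}(\theta)\left[\frac{\partial}{\partial\theta}\{\log\pi(\theta)+2\ell_n(\theta)\}+\frac12\sum_{r=1}^p\sum_{s=1}^pH_n^{rs}(\theta)A_{n,rs}(\theta)\right]+o_p(n^{-1}),$$ where $A_{n,rs}(\theta)$ is the $p$-dimensional vector with elements $A_{n,rsv}(\theta)=K_{n,vrs}(\theta)+2J_{n,vr,s}(\theta)+\sum_{t=1}^p\sum_{u=1}^pH_n^{tu}(\theta)I_{n,su}(\theta)K_{n,rtv}(\theta)$ $(v=1,\ldots,p)$, and the expectation of the remainder term $o_p(n^{-1})$ in this expansion is assumed to be $o(n^{-1})$.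
   Formalization: Added, as the claim fails without them: for large n the score at θ is integrable with mean zero, and the change in the bracketed leading term (times H_n^{-1}) when H_n, K_n are replaced by H, K is asymptotically uniformly integrable; θ^B is assumed measurable. *)

(* Defs.v *)
From HB Require Import structures.
From mathcomp Require Import all_boot all_order all_algebra.
From mathcomp Require Import all_classical all_reals all_analysis.

Set Implicit Arguments.
Unset Strict Implicit.
Unset Printing Implicit Defensive.

Import Order.TTheory GRing.Theory Num.Theory.
Import numFieldNormedType.Exports.

Local Open Scope classical_set_scope.
Local Open Scope ring_scope.

Lemma sigma_finite_prod d1 d2 (T1 : measurableType d1) (T2 : measurableType d2)
    (R : realType) (m1 : {sigma_finite_measure set T1 -> \bar R})
    (m2 : {sigma_finite_measure set T2 -> \bar R}) :
  sigma_finite setT (m1 \x m2)%E.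
Proof.
have /sigma_finiteP[F [TF ndF Foo]] := sigma_finiteT m1.
have /sigma_finiteP[G [TG ndG Goo]] := sigma_finiteT m2.
exists (fun k => F k `*` G k).
  rewrite -setXTT TF TG; apply/seteqP; split=> [[x y]|[x y] [k _ []/= ? ?]].
    move=> [/= [k _ Fx] [l _ Gy]]; exists (maxn k l) => //; split.
    - by move: x Fx; exact/subsetPset/ndF/leq_maxl.
    - by move: y Gy; exact/subsetPset/ndG/leq_maxr.
  by split; exists k.
move=> k; have [mF Fk] := Foo k; have [mG Gk] := Goo k.
split; first exact: measurableX.
by rewrite product_measure1E// lte_mul_pinfty// ge0_fin_numE.
Qed.

Section lebesgue_tuple.
Context {R : realType}.

Definition cons_pair n (z : measurableTypeR R * n.-tuple (measurableTypeR R)) :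
  n.+1.-tuple (measurableTypeR R) := [tuple of z.1 :: z.2].

Lemma measurable_cons_pair n : measurable_fun setT (@cons_pair n).
Proof. by apply: measurable_cons; [exact: measurable_fst|exact: measurable_snd]. Qed.

Section cons_measure.
Variables (n : nat)
  (mu : {sigma_finite_measure set (n.-tuple (measurableTypeR R)) -> \bar R}).
Definition cons_measure : set (n.+1.-tuple (measurableTypeR R)) -> \bar R :=
  pushforward (lebesgue_measure \x mu)%E (@cons_pair n).
Let cm0 : cons_measure set0 = 0%E.
Proof. by rewrite /cons_measure /pushforward preimage_set0 measure0. Qed.
Let cm_ge0 A : (0 <= cons_measure A)%E.
Proof. by rewrite /cons_measure /pushforward; apply: measure_ge0. Qed.
Let cm_sigma_additive : semi_sigma_additive cons_measure.
Proof.
move=> F mF tF mUF; rewrite /cons_measure /pushforward preimage_bigcup.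
have mc A : measurable A -> measurable (@cons_pair n @^-1` A).
  by move=> mA; rewrite -[X in measurable X]setTI; exact: measurable_cons_pair.
apply: measure_semi_sigma_additive => [k||].
- exact: mc.
- apply/trivIsetP => /= i j _ _ ij; rewrite -preimage_setI.
  by move/trivIsetP : tF => /(_ _ _ _ _ ij) ->//; rewrite preimage_set0.
- by rewrite -preimage_bigcup; exact: mc.
Qed.

HB.instance Definition _ :=
  isMeasure.Build _ _ _ cons_measure cm0 cm_ge0 cm_sigma_additive.

Let sf : sigma_finite setT cons_measure.
Proof.
have /sigma_finiteP[F [TF ndF Foo]] :=
  sigma_finite_prod lebesgue_measure mu.
pose u (t : n.+1.-tuple (measurableTypeR R)) := (thead t, [tuple of behead t]).
have uK z : u (cons_pair z) = z.
  by case: z => x t; rewrite /u /cons_pair /= theadE; congr pair; exact: val_inj.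
have mu_ : measurable_fun setT u.
  apply/measurable_fun_pairP => /=; split; first exact: measurable_tnth.
  exact: measurable_behead.
exists (fun k => u @^-1` F k).
  by rewrite -preimage_bigcup -TF preimage_setT.
move=> k; have [mF Fk] := Foo k; split.
  by rewrite -[X in measurable X]setTI; exact: mu_.
rewrite /cons_measure /pushforward.
rewrite (_ : _ @^-1` _ = F k)//.
by apply/seteqP; split=> z /=; rewrite uK.
Qed.

HB.instance Definition _ := Measure_isSigmaFinite.Build _ _ _ cons_measure sf.

End cons_measure.

(* Lebesgue measure on R^n, as the n-fold product of Lebesgue measure on R. *)
Fixpoint lebesgue_tuple n :
    {sigma_finite_measure set (n.-tuple (measurableTypeR R)) -> \bar R} :=
  match n with
  | 0 => (\d_([tuple] : 0.-tuple (measurableTypeR R)) :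
           {sigma_finite_measure set _ -> \bar R})
  | m.+1 => cons_measure (lebesgue_tuple m)
  end.

End lebesgue_tuple.

Section stochastic_order.
Context {R : realType} {d : measure_display} {Om : measurableType d}
  (P : probability Om R).

(* The exceptional event is only required to be covered by a measurable set of
   small probability: the derivatives below are defined almost surely, so the
   set itself need not be measurable.  When it is, this is the usual bound on
   its probability. *)
Definition outer_le (A : set Om) (eps : R) : Prop :=
  exists B, [/\ measurable B, (P B <= eps%:E)%E & A `<=` B].

Definition Op {V : normedModType R} (Y : nat -> Om -> V) (a : nat -> R) : Prop :=
  forall eps : R, 0 < eps -> exists M : R,
    \forall n \near \oo, outer_le [set w | M * a n < `|Y n w|] eps.

Definition op {V : normedModType R} (Y : nat -> Om -> V) (a : nat -> R) : Prop :=
  forall delta : R, 0 < delta -> forall eps : R, 0 < eps ->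
    \forall n \near \oo, outer_le [set w | delta * a n < `|Y n w|] eps.

Definition asymptotically_uniformly_integrable (Y : nat -> Om -> R) : Prop :=
  (\forall n \near \oo, P.-integrable setT (fun w => (Y n w)%:E)) /\
  forall eps : R, 0 < eps -> exists M : R, \forall n \near \oo,
    (\int[P]_(w in [set w | (M < `|Y n w|)%R]) `|Y n w|%R%:E <= eps%:E)%E.

Definition vec_integrable {p} (Y : Om -> 'cV[R]_p) : Prop :=
  forall v, P.-integrable setT (fun w => (Y w v 0)%:E).

Definition vec_expectation {p} (Y : Om -> 'cV[R]_p) : 'cV[R]_p :=
  \col_v fine 'E_P[fun w => Y w v 0].

End stochastic_order.

Section calculus.
Context {R : realType} {p : nat}.
Implicit Types (g : 'cV[R]_p -> R) (t : 'cV[R]_p).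

Definition partial (i : 'I_p) g : 'cV[R]_p -> R := 'D_(delta_mx i 0) g.

Definition grad g t : 'cV[R]_p := \col_i partial i g t.

(* For open A, the class C^k on A. *)
Fixpoint Ck_on (k : nat) (A : set 'cV[R]_p) g : Prop :=
  (forall t, A t -> {for t, continuous g}) /\
  if k is k'.+1 then
    forall i, (forall t, A t -> derivable g t (delta_mx i 0)) /\
              Ck_on k' A (partial i g)
  else True.

Definition posdef (M : 'M[R]_p) : Prop :=
  M^T = M /\ forall x : 'cV[R]_p, x != 0 -> 0 < (x^T *m M *m x) 0 0.

Definition box (B : 'I_p -> interval R) : set 'cV[R]_p :=
  [set t | forall i, t i 0 \in B i].

Section likelihood_derivatives.
Variables (n : nat) (l : 'cV[R]_p -> R) (t : 'cV[R]_p).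

Definition Hn : 'M[R]_p :=
  \matrix_(r, s) (- (n%:R^-1 * partial r (partial s l) t)).

Definition In : 'M[R]_p :=
  \matrix_(r, s) (n%:R^-1 * (partial r l t * partial s l t)).

Definition Jn (r s u : 'I_p) : R :=
  n%:R^-1 * (partial r (partial s l) t * partial u l t).

Definition Kn (r s u : 'I_p) : R :=
  n%:R^-1 * partial r (partial s (partial u l)) t.

End likelihood_derivatives.

(* [G] stands for the inverse of H (resp. H_n), whose entries are H^{rs}. *)
Definition Avec (G I : 'M[R]_p) (J K : 'I_p -> 'I_p -> 'I_p -> R)
    (r s : 'I_p) : 'cV[R]_p :=
  \col_v (K v r s + 2 * J v r s + \sum_t \sum_u G t u * I s u * K r t v).

Definition correction (G : 'M[R]_p) (A : 'I_p -> 'I_p -> 'cV[R]_p) : 'cV[R]_p :=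
  2^-1 *: \sum_r \sum_s G r s *: A r s.

End calculus.

Section model.
Context {R : realType} {p : nat} {d d' : measure_display}
  {T : measurableType d} {Om : measurableType d'}.
Variables (P : probability Om R) (X : nat -> {RV P >-> T})
  (mu : forall n, {sigma_finite_measure set (n.-tuple T) -> \bar R})
  (f : forall n, 'cV[R]_p -> n.-tuple T -> R)
  (Theta : set 'cV[R]_p) (theta : 'cV[R]_p) (prior : 'cV[R]_p -> R).

Definition sample n (w : Om) : n.-tuple T := [tuple X i w | i < n].

(* [f] is a family of densities with respect to [mu n], a reference measure
   on the space of samples of size [n] (e.g. an n-fold product), and under [P]
   the first [n] observations have the density with parameter [theta]. *)
Definition joint_density : Prop :=
  (forall n t, Theta t ->
     [/\ measurable_fun setT (@f n t), forall x, 0 <= @f n t x &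
         (\int[mu n]_x (@f n t x)%:E = 1)%E]) /\
  forall n (A : set (n.-tuple T)), measurable A ->
    P [set w | A (sample n w)] = (\int[mu n]_(x in A) (@f n theta x)%:E)%E.

Definition loglik n (w : Om) (t : 'cV[R]_p) : R := ln (f t (sample n w)).

Definition col_of (u : p.-tuple (measurableTypeR R)) : 'cV[R]_p :=
  \col_i (tnth u i : R).

Definition col_preimage : set (p.-tuple (measurableTypeR R)) :=
  [set u | Theta (col_of u)].

(* Unnormalised posterior density.  The factor exp(loglik) is written as the
   likelihood itself because [ln 0 = 0]: on the boundary of [Theta] the density
   may vanish, and exp(ln 0) would then be 1. *)
Definition posterior n w (u : p.-tuple (measurableTypeR R)) : R :=
  prior (col_of u) * f (col_of u) (sample n w).

Definition posterior_mean_exists n w : Prop :=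
  [/\ (lebesgue_tuple p).-integrable col_preimage
        (fun u => (posterior n w u)%:E),
      0 < \int[lebesgue_tuple p]_(u in col_preimage) posterior n w u &
      forall v, (lebesgue_tuple p).-integrable col_preimage
        (fun u => (col_of u v 0 * posterior n w u)%:E)].

Definition bayes n w : 'cV[R]_p :=
  \col_v ((\int[lebesgue_tuple p]_(u in col_preimage)
             (col_of u v 0 * posterior n w u)) /
          (\int[lebesgue_tuple p]_(u in col_preimage) posterior n w u)).

Definition score_part n w : 'cV[R]_p :=
  grad (fun t => ln (prior t) + 2 * loglik n w t) theta.

Definition leading n w : 'cV[R]_p :=
  let l := loglik n w in
  let G := invmx (Hn n l theta) in
  G *m (score_part n w +
        correction G (Avec G (In n l theta) (Jn n l theta) (Kn n l theta))).

(* The same, with H_n and K_n replaced by [H] and [K]. *)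
Definition leading_lim (H : 'M[R]_p) (K : 'I_p -> 'I_p -> 'I_p -> R) n w :
    'cV[R]_p :=
  let l := loglik n w in
  let G := invmx H in
  G *m (score_part n w +
        correction G (Avec G (In n l theta) (Jn n l theta) K)).

Definition expansion_remainder n w : 'cV[R]_p :=
  bayes n w - theta - n%:R^-1 *: leading n w.

End model.

(* Main.v *)
Require Import Defs.
From HB Require Import structures.
From mathcomp Require Import all_boot all_order all_algebra.
From mathcomp Require Import all_classical all_reals all_analysis.
From mathcomp Require Import measurable_realfun ring lra.

Set Implicit Arguments.
Unset Strict Implicit.
Unset Printing Implicit Defensive.

Import Order.TTheory GRing.Theory Num.Theory.
Import numFieldNormedType.Exports.

Local Open Scope classical_set_scope.
Local Open Scope ring_scope.

(* Write S for the score at theta and D = H_n - H, and note that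
   sum_{r,s} H_n^{rs} J_{n,vr,s} = - S_v identically.  Hence the score enters
   the leading term of the expansion as H_n^{-1} S, and the leading term with
   limits substituted as (2 H^{-1} - H^{-1} H_n H^{-1}) S.  Their difference
   H^{-1} D H_n^{-1} D H^{-1} S is O_p(n^{-1}) O_p(n^{1/2}): the J-term cancels
   the first-order error of replacing H_n^{-1} by H^{-1}.  So the two leading
   terms differ by o_p(1), by uniform integrability also in mean, and the mean
   of the second one is computed by linearity. *)

(** * Events covered by measurable sets of small probability *)

Section outer_probability.
Context {R : realType} {d : measure_display} {Om : measurableType d}
  (P : probability Om R).
Implicit Types (A B : set Om) (e : R).

Lemma outer_leS A B e : A `<=` B -> outer_le P B e -> outer_le P A e.
Proof.
by move=> AB [C [mC PC BC]]; exists C; split=> //; exact: subset_trans BC.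
Qed.

Lemma outer_leU A B e1 e2 :
  outer_le P A e1 -> outer_le P B e2 -> outer_le P (A `|` B) (e1 + e2).
Proof.
move=> [C [mC PC AC]] [D [mD PD BD]]; exists (C `|` D); split.
- exact: measurableU.
- rewrite EFinD; apply: le_trans (leeD PC PD).
  exact: measureU2.
- exact: setUSS.
Qed.

Lemma outer_leU2 A B e :
  outer_le P A (e / 2) -> outer_le P B (e / 2) -> outer_le P (A `|` B) e.
Proof. by rewrite {3}(splitr e); exact: outer_leU. Qed.

Lemma outer_le_ae (Q : set Om) e : 0 <= e -> {ae P, forall w, Q w} ->
  outer_le P (~` Q) e.
Proof.
by move=> e0 [B [mB PB QB]]; exists B; split=> //; rewrite PB lee_fin.
Qed.

End outer_probability.

(** * Calculus of O_p and o_p *)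

Section stochastic_order_calculus.
Context {R : realType} {d : measure_display} {Om : measurableType d}
  (P : probability Om R).
Implicit Types (U V W : normedModType R) (a b : nat -> R).

(** The constant in [Op] may be negative or zero, while later estimates multiply and divide by it.
    Enlarging it to [|M| + 1] shrinks the exceptional event only when the rate is nonnegative, hence
    the guard [0 <= a n]. *)
Lemma OpP V (Y : nat -> Om -> V) a : Op P Y a ->
  forall eps : R, 0 < eps -> exists2 M : R, 0 < M &
    \forall n \near \oo,
      0 <= a n -> outer_le P [set w | M * a n < `|Y n w|] eps.
Proof.
move=> + eps eps0 => /(_ _ eps0)[M HM].
exists (`|M| + 1); first by rewrite ltr_wpDl.
near=> n.
have h : outer_le P [set w | M * a n < `|Y n w|] eps by near: n.
move=> an; apply: outer_leS h => w /=; apply: le_lt_trans; rewrite ler_wpM2r//.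
by rewrite (le_trans (ler_norm M))// lerDl.
Unshelve. all: by end_near. Qed.

Lemma op_ae V (Y Z : nat -> Om -> V) a :
  (\forall n \near \oo, {ae P, forall w, Y n w = Z n w}) ->
  op P Y a -> op P Z a.
Proof.
move=> YZ oY delta delta0 eps eps0; have e2 := divr_gt0 eps0 (ltr0n R 2).
have HM := oY _ delta0 _ e2.
near=> n.
have h1 : outer_le P [set w | delta * a n < `|Y n w|] (eps / 2).
  by near: n.
have h2 : {ae P, forall w, Y n w = Z n w} by near: n.
apply: outer_leS (outer_leU2 h1 (outer_le_ae (ltW e2) h2)).
by move=> w; have [YZw|] := EM (Y n w = Z n w); [rewrite /= -YZw; left|right].
Unshelve. all: by end_near. Qed.

Lemma Op_dominated V W (Y : nat -> Om -> V) (Z : nat -> Om -> W) a :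
  (forall n w, `|Y n w| <= `|Z n w|) -> Op P Z a -> Op P Y a.
Proof.
move=> YZ OZ eps /OZ[M HM]; exists M; near=> n.
have h : outer_le P [set w | M * a n < `|Z n w|] eps by near: n.
by apply: outer_leS h => w /= /lt_le_trans; apply.
Unshelve. all: by end_near. Qed.

Lemma op_dominated V W (Y : nat -> Om -> V) (Z : nat -> Om -> W) a :
  (forall n w, `|Y n w| <= `|Z n w|) -> op P Z a -> op P Y a.
Proof.
move=> YZ oZ delta delta0 eps eps0; have HM := oZ _ delta0 _ eps0; near=> n.
have h : outer_le P [set w | delta * a n < `|Z n w|] eps by near: n.
by apply: outer_leS h => w /= /lt_le_trans; apply.
Unshelve. all: by end_near. Qed.

Lemma op_Op V (Y : nat -> Om -> V) a : op P Y a -> Op P Y a.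
Proof. by move=> oY eps; exists 1; exact: oY. Qed.

Lemma Op_le_rate V (Y : nat -> Om -> V) a b :
  (\forall n \near \oo, 0 <= a n <= b n) -> Op P Y a -> Op P Y b.
Proof.
move=> ab /OpP OY eps /OY[M M0 HM]; exists M; near=> n.
have /andP[a0 abn] : 0 <= a n <= b n by near: n.
have h : 0 <= a n -> outer_le P [set w | M * a n < `|Y n w|] eps by near: n.
by apply: outer_leS (h a0) => w /=; apply: le_lt_trans; rewrite ler_pM2l.
Unshelve. all: by end_near. Qed.

Lemma op_le_rate V (Y : nat -> Om -> V) a b :
  (\forall n \near \oo, a n <= b n) -> op P Y a -> op P Y b.
Proof.
move=> ab oY delta delta0 eps eps0; have HM := oY _ delta0 _ eps0; near=> n.
have abn : a n <= b n by near: n.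
have h : outer_le P [set w | delta * a n < `|Y n w|] eps by near: n.
by apply: outer_leS h => w /=; apply: le_lt_trans; rewrite ler_pM2l.
Unshelve. all: by end_near. Qed.

Lemma Op_op V (Y : nat -> Om -> V) a : (forall n, 0 <= a n) ->
  a @ \oo --> 0 -> Op P Y a -> op P Y (fun=> 1).
Proof.
move=> a0 acvg /OpP OY delta delta0 eps /OY[M M0 HM]; near=> n.
have h : 0 <= a n -> outer_le P [set w | M * a n < `|Y n w|] eps by near: n.
apply: outer_leS (h (a0 n)) => w /=; apply: le_lt_trans.
rewrite mulr1 -ler_pdivlMl// mulrC -[leLHS]ger0_norm ?a0//.
near: n; have /cvgrPdist_le/(_ (delta / M)) := acvg.
move=> /(_ (divr_gt0 delta0 M0)); apply: filterS => n.
by rewrite sub0r normrN.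
Unshelve. all: by end_near. Qed.

Lemma Op_cst V (c : V) : Op P (fun _ _ => c) (fun=> 1).
Proof.
move=> eps eps0; exists `|c|; apply: nearW => n; exists set0.
split=> //; rewrite ?measure0 ?lee_fin ?(ltW eps0)//.
by move=> w /=; rewrite mulr1 ltxx.
Qed.

Lemma OpD V (Y Z : nat -> Om -> V) a : Op P Y a -> Op P Z a ->
  Op P (fun n w => Y n w + Z n w) a.
Proof.
move=> OY OZ eps eps0; have e2 := divr_gt0 eps0 (ltr0n R 2).
have [M HM] := OY _ e2; have [N HN] := OZ _ e2; exists (M + N); near=> n.
have h1 : outer_le P [set w | M * a n < `|Y n w|] (eps / 2).
  by near: n.
have h2 : outer_le P [set w | N * a n < `|Z n w|] (eps / 2).
  by near: n.
apply: outer_leS (outer_leU2 h1 h2) => w /= h.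
have [?|hY] := ltP (M * a n) (`|Y n w|); [by left|right].
rewrite /= ltNge; apply/negP => hZ; move: h; rewrite ltNge.
by rewrite mulrDl (le_trans (ler_normD _ _))// lerD.
Unshelve. all: by end_near. Qed.

Lemma opD V (Y Z : nat -> Om -> V) a : op P Y a -> op P Z a ->
  op P (fun n w => Y n w + Z n w) a.
Proof.
move=> oY oZ delta delta0 eps eps0; have e2 := divr_gt0 eps0 (ltr0n R 2).
have d2 := divr_gt0 delta0 (ltr0n R 2).
have HM := oY _ d2 _ e2; have HN := oZ _ d2 _ e2; near=> n.
have h1 : outer_le P [set w | delta / 2 * a n < `|Y n w|] (eps / 2).
  by near: n.
have h2 : outer_le P [set w | delta / 2 * a n < `|Z n w|] (eps / 2).
  by near: n.
apply: outer_leS (outer_leU2 h1 h2) => w /= h.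
have [?|hY] := ltP (delta / 2 * a n) (`|Y n w|); [by left|right].
rewrite /= ltNge; apply/negP => hZ; move: h; rewrite ltNge.
by rewrite (splitr delta) mulrDl (le_trans (ler_normD _ _))// lerD.
Unshelve. all: by end_near. Qed.

Section bilinear.
Context {U V W : normedModType R} (f : U -> V -> W) (C : R).
Hypotheses (C0 : 0 < C) (fC : forall u v, `|f u v| <= C * (`|u| * `|v|)).
Variables (a b : nat -> R).
Hypotheses (a0 : forall n, 0 <= a n) (b0 : forall n, 0 <= b n).
Variables (Y : nat -> Om -> U) (Z : nat -> Om -> V).

(** The bound on [f] is all that is used of a product, so that scalar and matrix products are
    covered at once. Outside the union of the two exceptional events the norm bounds simply
    multiply. *)
Lemma Op_bilinear : Op P Y a -> Op P Z b ->
  Op P (fun n w => f (Y n w) (Z n w)) (fun n => a n * b n).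
Proof.
move=> /OpP OY /OpP OZ eps eps0; have e2 := divr_gt0 eps0 (ltr0n R 2).
have [M M0 HM] := OY _ e2; have [N N0 HN] := OZ _ e2.
exists (C * (M * N)); near=> n.
have h1 : 0 <= a n -> outer_le P [set w | M * a n < `|Y n w|] (eps / 2).
  by near: n.
have h2 : 0 <= b n -> outer_le P [set w | N * b n < `|Z n w|] (eps / 2).
  by near: n.
apply: outer_leS (outer_leU2 (h1 (a0 n)) (h2 (b0 n))) => w /= h.
have [?|hY] := ltP (M * a n) (`|Y n w|); [by left|right].
rewrite /= ltNge; apply/negP => hZ; move: h; rewrite ltNge.
rewrite (le_trans (fC _ _))// -mulrA ler_pM2l// mulrACA.
by rewrite ler_pM.
Unshelve. all: by end_near. Qed.

Lemma op_bilinear : op P Y a -> Op P Z b ->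
  op P (fun n w => f (Y n w) (Z n w)) (fun n => a n * b n).
Proof.
move=> oY /OpP OZ delta delta0 eps eps0; have e2 := divr_gt0 eps0 (ltr0n R 2).
have [N N0 HN] := OZ _ e2.
(* This tolerance for [Y], multiplied by the bound [N] on [Z] and by [C], gives back exactly
   [delta]. *)
have dCN : 0 < delta / (C * N) by rewrite divr_gt0// mulr_gt0.
have HM := oY _ dCN _ e2; near=> n.
have h1 : outer_le P [set w | delta / (C * N) * a n < `|Y n w|] (eps / 2).
  by near: n.
have h2 : 0 <= b n -> outer_le P [set w | N * b n < `|Z n w|] (eps / 2).
  by near: n.
apply: outer_leS (outer_leU2 h1 (h2 (b0 n))) => w /= h.
have [?|hY] := ltP (delta / (C * N) * a n) (`|Y n w|); [by left|right].
rewrite /= ltNge; apply/negP => hZ; move: h; rewrite ltNge.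
rewrite (le_trans (fC _ _))//.
have -> : delta * (a n * b n) = C * ((delta / (C * N) * a n) * (N * b n)).
  by field; rewrite ?gt_eqF.
by rewrite ler_pM2l// ler_pM.
Unshelve. all: by end_near. Qed.

End bilinear.

End stochastic_order_calculus.

(** * The maximum norm of matrices and perturbation of the inverse *)

Section matrix_norm.
Context {R : realType}.

Lemma entry_le_norm m n (A : 'M[R]_(m, n)) i j : `|A i j| <= `|A|.
Proof.
rewrite [leRHS]mx_normrE.
exact: (le_bigmax _ (fun ij : 'I_m * 'I_n => `|A ij.1 ij.2|) (i, j)).
Qed.

Lemma norm_le_entries m n (A : 'M[R]_(m, n)) (c : R) :
  0 <= c -> (forall i j, `|A i j| <= c) -> `|A| <= c.
Proof. by move=> c0 Ac; rewrite [leLHS]mx_normrE; apply/bigmax_leP; split. Qed.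

Lemma entry_subsub n (x y z : 'cV[R]_n) (a : R) v :
  (x - y - a *: z) v 0 = x v 0 - y v 0 - a * z v 0.
Proof. by rewrite !mxE. Qed.

Lemma norm_mulmx m n q (A : 'M[R]_(m, n)) (B : 'M[R]_(n, q)) :
  `|A *m B| <= n%:R * (`|A| * `|B|).
Proof.
apply: norm_le_entries => [|i j]; first by rewrite !mulr_ge0.
rewrite mxE (le_trans (ler_norm_sum _ _ _))//.
have -> : n%:R * (`|A| * `|B|) = \sum_(k < n) `|A| * `|B|.
  by rewrite sumr_const card_ord mulr_natl.
by apply: ler_sum => k _; rewrite normrM ler_pM// entry_le_norm.
Qed.

(** The resolvent identity F - G = - G (B - A) F gives [|F - G| <= k * |F|], where each matrix
    product costs a factor [n] in the maximum norm. The smallness condition says [k <= 1/2], so the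
    triangle inequality yields [|F| <= 2 * |G|], and this is fed back into the first bound. *)
Lemma invmx_perturbation n (A B : 'M[R]_n) : A \in unitmx -> B \in unitmx ->
  2 * (n%:R * (n%:R * (`|invmx A| * `|B - A|))) <= 1 ->
  `|invmx B - invmx A| <=
    2 * (n%:R * (n%:R * (`|invmx A| * `|B - A|))) * `|invmx A|.
Proof.
move=> uA uB; set k := n%:R * _; set G := invmx A; set F := invmx B => k1.
have k0 : 0 <= k by rewrite !mulr_ge0.
have FG : F - G = - (G *m (B - A) *m F).
  by rewrite mulmxBr mulmxBl mulVmx// mul1mx -mulmxA mulmxV// mulmx1 opprB.
have FGk : `|F - G| <= k * `|F|.
  rewrite FG normrN (le_trans (norm_mulmx _ _))// /k -!mulrA ler_wpM2l//.
  by rewrite !mulrA ler_wpM2r// -!mulrA norm_mulmx.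
have : `|F| <= `|F - G| + `|G| by rewrite -{1}(subrK G F) ler_normD.
move: k1 => k1 Fle; have F2 : `|F| <= 2 * `|G|.
  have := ler_wpM2r (normr_ge0 F) k1; lra.
by have := ler_wpM2l k0 F2; lra.
Qed.

End matrix_norm.

(** * Bounded sequences that agree up to o_p(1) *)

Section equivalence_in_probability.
Context {R : realType} {d : measure_display} {Om : measurableType d}
  (P : probability Om R).

(* Boundedness of both sides makes this relation compatible with products. *)
Definition peqv (Y Z : nat -> Om -> R^o) : Prop :=
  [/\ Op P Y (fun=> 1), Op P Z (fun=> 1) &
      op P (fun n w => Y n w - Z n w : R^o) (fun=> 1)].

Let normM (x y : R^o) : `|x * y : R^o| <= 1 * (`|x| * `|y|).
Proof. by rewrite mul1r normrM. Qed.

Let one_ge0 (n : nat) : 0 <= 1 :> R. Proof. exact: ler01. Qed.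

Let OpM1 (Y Z : nat -> Om -> R^o) : Op P Y (fun=> 1) -> Op P Z (fun=> 1) ->
  Op P (fun n w => Y n w * Z n w : R^o) (fun=> 1).
Proof.
move=> OY OZ; apply: Op_le_rate (Op_bilinear ltr01 normM one_ge0 one_ge0 OY OZ).
by apply: nearW => n; rewrite mul1r ?ler01 lexx.
Qed.

Let opM1 (Y Z : nat -> Om -> R^o) : op P Y (fun=> 1) -> Op P Z (fun=> 1) ->
  op P (fun n w => Y n w * Z n w : R^o) (fun=> 1).
Proof.
move=> OY OZ; apply: op_le_rate (op_bilinear ltr01 normM one_ge0 OY OZ).
by apply: nearW => n; rewrite mul1r ?ler01 lexx.
Qed.

Lemma peqv_refl Y : Op P Y (fun=> 1) -> peqv Y Y.
Proof.
move=> OY; split=> // delta delta0 eps eps0; apply: nearW => n; exists set0.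
split=> //; rewrite ?measure0 ?lee_fin ?(ltW eps0)//.
by move=> w /=; rewrite subrr normr0 mulr1 ltNge (ltW delta0).
Qed.

Lemma peqv_cst (c : R) : peqv (fun _ _ => c) (fun _ _ => c).
Proof. by apply: peqv_refl; exact: Op_cst. Qed.

Lemma peqv_op (Y : nat -> Om -> R) (c : R) :
  op P (fun n w => Y n w - c : R^o) (fun=> 1) -> peqv Y (fun _ _ => c).
Proof.
move=> oY; split=> //; last exact: Op_cst.
have -> : Y = fun n w => Y n w - c + c.
  by apply/funext=> n; apply/funext => w; rewrite subrK.
by apply: OpD; [exact: op_Op|exact: Op_cst].
Qed.

Lemma peqvD Y Z Y' Z' : peqv Y Y' -> peqv Z Z' ->
  peqv (fun n w => Y n w + Z n w) (fun n w => Y' n w + Z' n w).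
Proof.
move=> [OY OY' oY] [OZ OZ' oZ]; split; [exact: OpD|exact: OpD|].
have -> : (fun n w => Y n w + Z n w - (Y' n w + Z' n w)) =
          (fun n w => (Y n w - Y' n w) + (Z n w - Z' n w)).
  by apply/funext=> n; apply/funext => w; ring.
exact: opD.
Qed.

Lemma peqvM Y Z Y' Z' : peqv Y Y' -> peqv Z Z' ->
  peqv (fun n w => Y n w * Z n w) (fun n w => Y' n w * Z' n w).
Proof.
move=> [OY OY' oY] [OZ OZ' oZ]; split; [exact: OpM1|exact: OpM1|].
(* Telescoping pairs each negligible difference with a factor bounded in probability. *)
have -> : (fun n w => Y n w * Z n w - Y' n w * Z' n w) =
          (fun n w => (Y n w - Y' n w) * Z n w + (Z n w - Z' n w) * Y' n w).
  by apply/funext=> n; apply/funext => w; ring.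
by apply: opD; exact: opM1.
Qed.

Lemma peqv_sum (J : finType) (Y Z : J -> nat -> Om -> R) :
  (forall i, peqv (Y i) (Z i)) ->
  peqv (fun n w => \sum_i Y i n w) (fun n w => \sum_i Z i n w).
Proof.
move=> YZ; elim: (index_enum J) => [|i r IH].
  under eq_fun do under eq_fun do rewrite big_nil.
  under [X in peqv _ X]eq_fun do under eq_fun do rewrite big_nil.
  exact: peqv_cst.
under eq_fun do under eq_fun do rewrite big_cons.
under [X in peqv _ X]eq_fun do under eq_fun do rewrite big_cons.
exact: peqvD.
Qed.

End equivalence_in_probability.

(** * Convergence of expectations and its linearity *)

Section mean_convergence.
Context {R : realType} {d : measure_display} {Om : measurableType d}
  (P : probability Om R).
Implicit Types (Y Z : nat -> Om -> R) (a b : R).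

(** Integrability is carried along because linearity of the integral requires it, and because the
    real-valued integral of a non-integrable function may be a mere default value. *)
Definition mean_cvg Y a : Prop :=
  (\forall n \near \oo, P.-integrable setT (fun w => (Y n w)%:E)) /\
  \int[P]_w Y n w @[n --> \oo] --> a.

Lemma mean_cvg_cst a : mean_cvg (fun _ _ => a) a.
Proof.
split; first by apply: nearW => n; exact: finite_measure_integrable_cst.
have /(congr1 fine)/= PT := @probability_setT _ _ _ P.
rewrite Rintegral_cst// PT mulr1; exact: cvg_cst.
Qed.

Lemma mean_cvgD Y Z a b : mean_cvg Y a -> mean_cvg Z b ->
  mean_cvg (fun n w => Y n w + Z n w) (a + b).
Proof.
move=> [iY cY] [iZ cZ]; split.
  by apply: filterS2 iY iZ => n iY iZ; have := integrableD measurableT iY iZ.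
apply: cvg_trans (cvgD cY cZ); apply: near_eq_cvg.
by apply: filterS2 iY iZ => n iY iZ; rewrite RintegralD.
Qed.

Lemma mean_cvgZ Y a (c : R) : mean_cvg Y a ->
  mean_cvg (fun n w => c * Y n w) (c * a).
Proof.
move=> [iY cY]; split.
  by apply: filterS iY => n iY; have := integrableZl measurableT c iY.
have : c * \int[P]_w Y n w @[n --> \oo] --> c * a by exact: cvgZr.
apply: cvg_trans; apply: near_eq_cvg.
by apply: filterS iY => n iY; rewrite RintegralZl.
Qed.

Lemma mean_cvg_sum (J : finType) (Y : J -> nat -> Om -> R) (a : J -> R) :
  (forall i, mean_cvg (Y i) (a i)) ->
  mean_cvg (fun n w => \sum_i Y i n w) (\sum_i a i).
Proof.
move=> Ya; elim: (index_enum J) => [|i r IH].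
  under eq_fun do under eq_fun do rewrite big_nil.
  by rewrite big_nil; exact: mean_cvg_cst.
under eq_fun do under eq_fun do rewrite big_cons.
by rewrite big_cons; exact: mean_cvgD.
Qed.

(** [P] is not assumed complete, so almost sure equality does not transfer measurability; that of
    [h] is a separate hypothesis. *)
Lemma integrable_ae_eq (g h : Om -> R) : measurable_fun setT h ->
  {ae P, forall w, g w = h w} -> P.-integrable setT (EFin \o g) ->
  P.-integrable setT (EFin \o h) /\ \int[P]_w h w = \int[P]_w g w.
Proof.
move=> mh gh ig; have mg := measurable_int _ ig.
have /measurable_EFinP mEh := mh.
have gh' : ae_eq P setT (EFin \o g) (EFin \o h) by apply: filterS gh => w /= ->.
split; last by congr fine; apply/esym/ae_eq_integral.
apply/integrableP; split=> //; have /integrableP[_] := ig.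
rewrite (ae_eq_integral (fun w => `|(EFin \o h) w|%E))//.
- exact: measurableT_comp.
- exact: measurableT_comp.
- by apply: filterS gh => w /= ->.
Qed.

Lemma mean_cvg_ae Y Z a : (\forall n \near \oo, measurable_fun setT (Z n)) ->
  (\forall n \near \oo, {ae P, forall w, Y n w = Z n w}) ->
  mean_cvg Y a -> mean_cvg Z a.
Proof.
move=> mZ YZ [iY cY]; split.
  apply: filterS3 mZ YZ iY => n mZ YZ iY.
  by have [] := integrable_ae_eq mZ YZ iY.
apply: cvg_trans cY; apply: near_eq_cvg.
by apply: filterS3 mZ YZ iY => n mZ YZ iY; have [] := integrable_ae_eq mZ YZ iY.
Qed.

End mean_convergence.

(** * Passing between means and probabilities: Markov and Vitali arguments *)

Section mean_and_probability.
Context {R : realType} {d : measure_display} {Om : measurableType d}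
  (P : probability Om R).

(** Markov's inequality: the means are eventually at most [c = |a| + 1], so the level [c / eps] is
    exceeded with probability at most [eps]. *)
Lemma mean_cvg_Op (Z : nat -> Om -> R) (a : R) : (forall n w, 0 <= Z n w) ->
  mean_cvg P Z a -> Op P (Z : nat -> Om -> R^o) (fun=> 1).
Proof.
move=> Z0 [iZ cZ] eps eps0; pose c := `|a| + 1.
have c0 : 0 < c by rewrite ltr_wpDl.
have ce0 : 0 < c / eps by rewrite divr_gt0.
exists (c / eps); near=> n.
have iZn : P.-integrable setT (fun w => (Z n w)%:E) by near: n.
have mZn : measurable_fun setT (Z n).
  exact/measurable_EFinP/(measurable_int _ iZn).
have EZ : \int[P]_w Z n w <= c.
  near: n; move/cvgrPdist_le : cZ => /(_ _ ltr01); apply: filterS => n h.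
  rewrite -(subrK a (\int[P]_w _)) /c addrC lerD ?ler_norm//.
  by rewrite (le_trans (ler_norm _))// distrC.
have mA : measurable [set w | c / eps <= Z n w].
  rewrite -[X in measurable X]setTI.
  have := mZn measurableT `[c / eps, +oo[%classic.
  move=> /(_ (measurable_itv _)); congr measurable.
  by apply/seteqP; split=> w /=; rewrite in_itv/= andbT.
exists [set w | c / eps <= Z n w]; split=> //; last first.
  by move=> w /=; rewrite mulr1 ger0_norm// => /ltW.
have := le_integral_abse P measurableT (measurable_int _ iZn) ce0.
have -> : [set: Om] `&` [set w | ((c / eps)%:E <= `|(Z n w)%:E|)%E] =
          [set w | c / eps <= Z n w].
  by rewrite setTI; apply/seteqP; split=> w /=; rewrite lee_fin ger0_norm.
have -> : (\int[P]_w `|(Z n w)%:E| = (\int[P]_w Z n w)%:E)%E.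
  rewrite fineK ?integrable_fin_num//.
  by apply: eq_integral => w _ /=; rewrite ger0_norm.
move=> cP; rewrite -(@lee_pmul2l _ (c / eps)%:E) ?lte_fin// -EFinM.
by apply: le_trans cP _; rewrite divfK ?gt_eqF.
Unshelve. all: by end_near. Qed.

(** The argument of Vitali's theorem: uniform integrability controls the values above a level [M],
    and convergence in probability controls those below it. *)
Lemma aui_op_mean_cvg (Y : nat -> Om -> R) :
  asymptotically_uniformly_integrable P Y ->
  op P (Y : nat -> Om -> R^o) (fun=> 1) -> mean_cvg P Y 0.
Proof.
move=> [iY uY] oY; split=> //; apply/cvgrPdist_le => eps eps0.
have e3 : 0 < eps / 3 by rewrite divr_gt0.
have [M HM] := uY _ e3.
(* An event of this probability contributes at most [eps / 3] when the integrand is bounded by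
   [|M|]; the added 1 keeps the denominator positive. *)
have eta0 : 0 < eps / 3 / (`|M| + 1) by rewrite divr_gt0// ltr_wpDl.
have HB := oY _ e3 _ eta0.
near=> n.
have iYn : P.-integrable setT (fun w => (Y n w)%:E) by near: n.
have uYn : (\int[P]_(w in [set w | (M < `|Y n w|)%R]) `|Y n w|%R%:E <=
    (eps / 3)%:E)%E.
  by near: n.
have [B [mB PB YB]] : outer_le P [set w | eps / 3 * 1 < `|Y n w|]
    (eps / 3 / (`|M| + 1)) by near: n.
rewrite sub0r normrN -lee_fin EFin_normr_Rintegral//.
apply: le_trans (le_abse_integral P measurableT (measurable_int _ iYn)) _.
have mYn : measurable_fun setT (fun w => `|Y n w|%:E).
  by apply/measurable_EFinP; apply: measurableT_comp => //;
    exact/measurable_EFinP/(measurable_int _ iYn).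
have mA : measurable [set w | M < `|Y n w|].
  rewrite -[X in measurable X]setTI.
  have /measurable_EFinP mYn' := mYn.
  have := mYn' measurableT `]M, +oo[%classic (measurable_itv _).
  by congr measurable; apply/seteqP; split=> w /=; rewrite in_itv/= andbT.
pose g := (fun w => `|Y n w|%:E) \_ [set w | M < `|Y n w|].
have g0 w : (0 <= g w)%E.
  by rewrite /g patchE; case: ifP => // _; rewrite lee_fin.
have mg : measurable_fun setT g.
  rewrite /g; apply/measurable_restrict => //; rewrite setTI.
  exact: measurable_funS mYn.
pose b w := (`|M| * \1_B w)%:E.
have mb : measurable_fun setT b.
  by apply/measurable_EFinP; apply: measurable_funM.
have b0 w : (0 <= b w)%E by rewrite lee_fin mulr_ge0.
(* Pointwise, [g] dominates the values above [M], [b] the remaining values on the exceptional set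
   [B], and [eps / 3] everything else. Each of the three integrals is at most [eps / 3]. *)
apply: (@le_trans _ _ (\int[P]_w (g w + ((eps / 3)%:E + b w)))%E).
  apply: ge0_le_integral => //.
  by apply: emeasurable_funD => //; exact: emeasurable_funD.
  move=> w _.
  have [Mw|Mw] := ltP M `|Y n w|.
    rewrite /g patchE ifT ?inE// leeDl// adde_ge0// lee_fin ltW//.
  rewrite -[leLHS]add0e leeD//.
  have [Bw|Bw] := pselect (B w).
    rewrite -EFinD lee_fin indicE mem_set// mulr1.
    by rewrite (le_trans Mw)// (le_trans (ler_norm _))// lerDr ltW.
  rewrite -[leLHS]adde0 leeD// lee_fin leNgt; apply/negP => h.
  by apply: Bw; apply: YB => /=; rewrite mulr1.
rewrite ge0_integralD//; last 2 first.
- by move=> w _; rewrite adde_ge0// lee_fin ltW.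
- exact: emeasurable_funD.
rewrite ge0_integralD//; last by move=> w _; rewrite lee_fin ltW.
have -> : (\int[P]_w (eps / 3)%:E = (eps / 3)%:E)%E.
  rewrite integral_cst// -[RHS]mule1.
  by congr (_ * _)%E; exact: probability_setT.
rewrite /g -integral_mkcond.
have -> : (\int[P]_w b w = `|M|%:E * P B)%E.
  under eq_integral do rewrite /b EFinM.
  rewrite ge0_integralZl_EFin// ?integral_indic ?setIT//.
  exact/measurable_EFinP.
have -> : (eps%:E = (eps / 3)%:E + ((eps / 3)%:E + (eps / 3)%:E))%E.
  by rewrite -!EFinD; congr EFin; field.
apply: leeD => //; apply: leeD => //.
have M0 : (0 <= `|M|%:E)%E by rewrite lee_fin.
apply: le_trans (lee_wpmul2l M0 PB) _; rewrite -EFinM lee_fin.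
rewrite mulrCA ger_pMr// ler_pdivrMr ?mul1r ?lerDl// ltr_wpDl.
Unshelve. all: by end_near. Qed.

End mean_and_probability.

(** * Matrix identities behind the cancellation of the first-order error *)

Section likelihood_algebra.
Context {R : realType} {p : nat}.
Implicit Types (G F H I : 'M[R]_p) (J K : 'I_p -> 'I_p -> 'I_p -> R).

Lemma correctionE G (A : 'I_p -> 'I_p -> 'cV[R]_p) v :
  correction G A v 0 = 2^-1 * \sum_r \sum_s G r s * A r s v 0.
Proof.
rewrite mxE summxE; congr (_ * _); apply: eq_bigr => r _.
by rewrite summxE; apply: eq_bigr => s _; rewrite mxE.
Qed.

Lemma AvecE G I J K r s v : Avec G I J K r s v 0 =
  K v r s + 2 * J v r s + \sum_t \sum_u G t u * I s u * K r t v.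
Proof. by rewrite mxE. Qed.

(** J_n is a product of a second derivative and a score component, and [Hn] carries a minus sign.
    The sum of G^{rs} J_{n,vr,s} is therefore minus the v-th entry of H_n G S, and the factor 2 in
    [Avec] cancels the 1/2 in [correction]. *)
Lemma correction_Jn n l t G I K :
  correction G (Avec G I (Jn n l t) K) =
  correction G (Avec G I (fun _ _ _ => 0) K) - Hn n l t *m G *m grad l t.
Proof.
apply/colP => v; rewrite [RHS]mxE [in X in _ + X]mxE !correctionE.
have -> : (Hn n l t *m G *m grad l t) v 0 =
    - \sum_r \sum_s G r s * Jn n l t v r s.
  rewrite -mulmxA mxE -sumrN; apply: eq_bigr => r _.
  rewrite !mxE mulr_sumr -sumrN; apply: eq_bigr => s _.
  by rewrite !mxE /Jn; ring.
have two0 : 2 != 0 :> R by rewrite pnatr_eq0.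
rewrite opprK -[X in _ + X](mulKf two0) -mulrDr; congr (_ * _).
rewrite mulr_sumr -big_split; apply: eq_bigr => r _.
rewrite mulr_sumr -big_split; apply: eq_bigr => s _.
by rewrite !AvecE /=; ring.
Qed.

(** The first three factors collapse to [invmx H - invmx D]; multiplying out with the other two
    leaves the error of the first-order expansion of the inverse around [H]. *)
Lemma second_order_inverse H D : H \in unitmx -> D \in unitmx ->
  invmx H *m (D - H) *m invmx D *m (D - H) *m invmx H =
  invmx D - 2 *: invmx H + invmx H *m D *m invmx H.
Proof.
move=> uH uD.
have -> : invmx H *m (D - H) *m invmx D = invmx H - invmx D.
  by rewrite mulmxBr mulmxBl mulmxK// mulVmx// mul1mx.
rewrite mulmxBr !mulmxBl mulVmx// mulVmx// mul1mx mulmxK//.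
by rewrite scaler_nat mulr2n; apply/matrixP => i j; rewrite !mxE; ring.
Qed.

(** Once the J-terms are absorbed, the score has coefficient F (2 - H_n F) = F in the first
    expression and 2 G - G H_n G in the second. [second_order_inverse] identifies the difference as
    quadratic in H_n - H; what remains has J replaced by zero. *)
Lemma leading_difference n l t H I K0 (c : 'cV[R]_p)
    (Hl := Hn n l t) (K := Kn n l t) (S := grad l t)
    (F := invmx Hl) (G := invmx H) (J0 := fun _ _ _ : 'I_p => 0 : R) :
  H \in unitmx -> Hl \in unitmx ->
  F *m (c + 2 *: S + correction F (Avec F I (Jn n l t) K)) -
  G *m (c + 2 *: S + correction G (Avec G I (Jn n l t) K0)) =
  F *m (c + correction F (Avec F I J0 K)) -
  G *m (c + correction G (Avec G I J0 K0)) +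
  G *m (Hl - H) *m F *m (Hl - H) *m G *m S.
Proof.
move=> uH uHl; rewrite !correction_Jn second_order_inverse// -/Hl -/S -/F -/G.
rewrite mulmxV// mul1mx; set X := correction _ _; set Y := correction _ _.
rewrite !mulmxDl mulNmx !mulmxDr !mulmxN -!scalemxAr -!scalemxAl.
rewrite scaler_nat !mulmxA !mulr2n.
by apply/colP => i; rewrite ![in LHS]mxE ![in RHS]mxE; ring.
Qed.

End likelihood_algebra.

(** * The gradient of the log-prior plus twice the log-likelihood *)

Section score.
Context {R : realType} {p : nat}.

Lemma grad_log_posterior (prior l : 'cV[R]_p -> R) t :
  0 < prior t -> differentiable prior t ->
  (forall i, derivable l t (delta_mx i 0)) ->
  grad (fun u => ln (prior u) + 2 * l u) t =
  grad (fun u => ln (prior u)) t + 2 *: grad l t.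
Proof.
move=> prior0 dprior dl; apply/colP => i; rewrite !mxE /partial.
have dln : derivable (fun u => ln (prior u)) t (delta_mx i 0).
  apply: diff_derivable; apply: (differentiable_comp dprior).
  by apply/derivable1_diffP; have [] := is_derive1_ln prior0.
have -> : (fun u => ln (prior u) + 2 * l u) =
          (fun u => ln (prior u)) + 2 *: (l : _ -> R^o) by [].
by rewrite deriveD ?deriveZ//; exact: derivableZ.
Qed.

End score.

(** * Stochastic orders of matrix products, inverses and the score *)

Section matrix_stochastic_order.
Context {R : realType} {d : measure_display} {Om : measurableType d}
  (P : probability Om R).

Lemma Op_mulmx m n q (A : nat -> Om -> 'M[R]_(m, n))
    (B : nat -> Om -> 'M[R]_(n, q)) (a b c : nat -> R) :
  (forall k, 0 <= a k) -> (forall k, 0 <= b k) ->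
  (\forall k \near \oo, a k * b k <= c k) ->
  Op P A a -> Op P B b -> Op P (fun k w => A k w *m B k w) c.
Proof.
move=> a0 b0 abc OA OB.
(* [n.+1] rather than [n] keeps the constant positive when the inner dimension is 0. *)
apply: Op_le_rate (Op_bilinear (C := n.+1%:R) _ _ a0 b0 OA OB).
- by apply: filterS abc => k ->; rewrite mulr_ge0.
- by rewrite ltr0n.
- move=> X Y; apply: le_trans (norm_mulmx X Y) _.
  by apply: ler_wpM2r; [rewrite mulr_ge0|rewrite ler_nat].
Qed.

Lemma op_entry m n (A : nat -> Om -> 'M[R]_(m, n)) a i j :
  op P A a -> op P (fun k w => A k w i j : R^o) a.
Proof. by apply: op_dominated => k w; exact: entry_le_norm. Qed.

(** Since the rate tends to 0, the smallness condition of [invmx_perturbation] eventually holds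
    wherever [Y n w - H] obeys its bound. Points with singular [Y n w] lie in a null set, absorbed
    by half of [eps]. *)
Lemma Op_invmx p (Y : nat -> Om -> 'M[R]_p) (H : 'M[R]_p) (a : nat -> R) :
  (forall n, 0 <= a n) -> a @ \oo --> 0 -> H \in unitmx ->
  (\forall n \near \oo, {ae P, forall w, Y n w \in unitmx}) ->
  Op P (fun n w => Y n w - H) a ->
  Op P (fun n w => invmx (Y n w) - invmx H) a.
Proof.
move=> a0 acvg uH uY OY eps eps0; have e2 := divr_gt0 eps0 (ltr0n R 2).
have [M M0 HM] := OpP OY e2.
pose c := 2 * (p%:R * (p%:R * (`|invmx H| * M))).
have c0 : 0 <= c by rewrite !mulr_ge0// ltW.
exists (c * `|invmx H|); near=> n.
have h : 0 <= a n -> outer_le P [set w | M * a n < `|Y n w - H|] (eps / 2).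
  by near: n.
have u : {ae P, forall w, Y n w \in unitmx} by near: n.
have ca : c * a n <= 1.
  near: n; have : c * a n @[n --> \oo] --> c * 0 by exact: cvgZr.
  rewrite mulr0 => /cvgrPdist_le/(_ _ ltr01); apply: filterS => n.
  by rewrite sub0r normrN; apply: le_trans; exact: ler_norm.
apply: outer_leS (outer_leU2 (h (a0 n)) (outer_le_ae (ltW e2) u)) => w /= lt_w.
have [uw|] := boolP (Y n w \in unitmx); [left|by right; apply/negP].
rewrite ltNge; apply/negP => Yle; move: lt_w; rewrite ltNge => /negP; apply.
have le_c : 2 * (p%:R * (p%:R * (`|invmx H| * `|Y n w - H|))) <= c * a n.
  by rewrite /c -!mulrA !ler_wpM2l.
apply: le_trans (invmx_perturbation uH uw (le_trans le_c ca)) _.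
by rewrite [leRHS]mulrAC ler_wpM2r.
Unshelve. all: by end_near. Qed.

(** The normalised squares are nonnegative with convergent means, so their sum [Z] is bounded in
    probability by Markov; [Z] dominates both the squared score over n and the mixed products. *)
Lemma score_Op p (S : nat -> Om -> 'cV[R]_p) (a : 'I_p -> R) :
  (forall v, mean_cvg P (fun n w => n%:R^-1 * (S n w v 0 * S n w v 0)) (a v)) ->
  Op P S (fun n => Num.sqrt n%:R) /\
  forall r s,
    Op P (fun n w => n%:R^-1 * (S n w r 0 * S n w s 0) : R^o) (fun=> 1).
Proof.
move=> cS; pose Z n w := \sum_v n%:R^-1 * (S n w v 0 * S n w v 0).
have sq0 n w v : 0 <= n%:R^-1 * (S n w v 0 * S n w v 0).
  by rewrite mulr_ge0// -expr2 sqr_ge0.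
have Z0 n w : 0 <= Z n w by apply: sumr_ge0.
have sqZ n w v : n%:R^-1 * (S n w v 0 * S n w v 0) <= Z n w.
  by rewrite /Z (bigD1 v)//= lerDl sumr_ge0.
have OZ : Op P (Z : nat -> Om -> R^o) (fun=> 1).
  exact: mean_cvg_Op Z0 (mean_cvg_sum cS).
split=> [|r s].
- move=> eps eps0; have [M M0 HM] := OpP OZ eps0.
  exists (Num.sqrt M); near=> n.
  have n0 : 0 < n%:R :> R by rewrite ltr0n; near: n; exact: nbhs_infty_gt.
  have h : 0 <= 1 :> R -> outer_le P [set w | M * 1 < `|Z n w : R^o|] eps.
    by near: n.
  apply: outer_leS (h ler01) => w /= lt_w.
  rewrite mulr1 ger0_norm// ltNge; apply/negP => ZM.
  move: lt_w; rewrite ltNge => /negP; apply.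
  apply: norm_le_entries => [|i j]; first by rewrite mulr_ge0 ?sqrtr_ge0.
  rewrite ord1 -sqrtrM ?(ltW M0)// -sqrtr_sqr ler_wsqrtr// mulrC.
  by rewrite -ler_pdivrMl// expr2 (le_trans (sqZ _ _ _)).
- apply: Op_dominated OZ => n w; rewrite [leRHS]ger0_norm//.
  have n0 : 0 <= n%:R^-1 :> R by rewrite invr_ge0.
  have := sqZ n w r; have := sqZ n w s.
  rewrite ler_norml; set x := S n w r 0; set y := S n w s 0 => Hs Hr.
  (* Nonnegativity of the squares of [x + y] and [x - y] bounds the mixed product by half the sum of
     the two squares. *)
  have h1 : 0 <= n%:R^-1 * ((x + y) * (x + y)).
    by rewrite mulr_ge0// -expr2 sqr_ge0.
  have h2 : 0 <= n%:R^-1 * ((x - y) * (x - y)).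
    by rewrite mulr_ge0// -expr2 sqr_ge0.
  by apply/andP; split; lra.
Unshelve. all: by end_near. Qed.

Lemma root_rate_cvg0 : (Num.sqrt n%:R)^-1 @[n --> \oo] --> (0 : R).
Proof.
apply/cvgrPdist_le => eps eps0; near=> n.
have n_ge : eps^-1 ^+ 2 <= n%:R by near: n; exact: nbhs_infty_ger.
rewrite sub0r normrN ger0_norm ?invr_ge0 ?sqrtr_ge0//.
have e0 : 0 < eps^-1 by rewrite invr_gt0.
rewrite -[leRHS]invrK lef_pV2 ?posrE//; last first.
  by rewrite sqrtr_gt0; apply: lt_le_trans n_ge; rewrite exprn_gt0.
by rewrite -[leLHS]ger0_norm ?(ltW e0)// -sqrtr_sqr ler_wsqrtr.
Unshelve. all: by end_near. Qed.

(** Two factors [D] at the inverse root rate against one score at the root rate leave a net inverse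
    root rate, which tends to 0. *)
Lemma second_order_remainder p (F D : nat -> Om -> 'M[R]_p)
    (S : nat -> Om -> 'cV[R]_p) (G : 'M[R]_p) :
  Op P F (fun=> 1) -> Op P D (fun n => (Num.sqrt n%:R)^-1) ->
  Op P S (fun n => Num.sqrt n%:R) ->
  op P (fun n w => G *m D n w *m F n w *m D n w *m G *m S n w) (fun=> 1).
Proof.
pose s n : R := Num.sqrt n%:R; rewrite -/s => OF OD OS.
have s0 n : 0 <= s n by rewrite sqrtr_ge0.
have r0 n : 0 <= (s n)^-1 by rewrite invr_ge0.
have one0 (n : nat) : 0 <= 1 :> R by [].
have OG : Op P (fun _ _ => G) (fun=> 1) by exact: Op_cst.
have rr0 n : 0 <= (s n)^-1 * (s n)^-1 by rewrite mulr_ge0.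
apply: (Op_op r0 root_rate_cvg0).
apply: (Op_mulmx (a := fun n => (s n)^-1 * (s n)^-1) (b := s)) OS => //.
  apply: nearW => n.
  (* At [n = 0] the root vanishes and its inverse is 0 by convention, so both sides are 0. *)
  have [->|sn0] := eqVneq (s n) 0; first by rewrite mulr0 invr0.
  by rewrite -mulrA mulVf// mulr1.
apply: (Op_mulmx (a := fun n => (s n)^-1 * (s n)^-1) (b := fun=> 1)) (OG) => //.
  by apply: nearW => n; rewrite mulr1.
apply: (Op_mulmx (a := fun n => (s n)^-1) (b := fun n => (s n)^-1)) (OD) => //.
  by apply: nearW.
apply: (Op_mulmx (a := fun n => (s n)^-1) (b := fun=> 1)) OF => //.
  by apply: nearW => n; rewrite mulr1.
apply: (Op_mulmx (a := fun=> 1) (b := fun n => (s n)^-1)) (OD) => //.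
by apply: nearW => n; rewrite mul1r.
Qed.

End matrix_stochastic_order.

(** * Mean of the leading term with limits, and replacement of H_n and K_n *)

Section mean_leading_limit.
Context {R : realType} {p : nat} {d : measure_display} {Om : measurableType d}
  (P : probability Om R).

(** With [G] and [K] constant, the score, [In] and [Jn] enter linearly, so means can be taken term
    by term. *)
Lemma mean_cvg_leading_lim (G I : 'M[R]_p) (J K : 'I_p -> 'I_p -> 'I_p -> R)
    (c : 'cV[R]_p) (S : nat -> Om -> 'cV[R]_p) (In : nat -> Om -> 'M[R]_p)
    (Jn : nat -> Om -> 'I_p -> 'I_p -> 'I_p -> R) :
  (forall v, mean_cvg P (fun n w => S n w v 0) 0) ->
  (forall r s, mean_cvg P (fun n w => In n w r s) (I r s)) ->
  (forall r s t, mean_cvg P (fun n w => Jn n w r s t) (J r s t)) ->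
  forall v, mean_cvg P
    (fun n w => (G *m (c + 2 *: S n w +
                       correction G (Avec G (In n w) (Jn n w) K))) v 0)
    ((G *m (c + correction G (Avec G I J K))) v 0).
Proof.
move=> cS cI cJ v.
under eq_fun do under eq_fun do rewrite mxE.
rewrite mxE; apply: mean_cvg_sum => j; apply: mean_cvgZ.
under eq_fun do under eq_fun do rewrite 2!mxE [X in _ + X + _]mxE.
(* The inserted [2 * 0] is the limiting contribution of the centred score. *)
rewrite mxE -[X in mean_cvg _ _ (X + _)]addr0 -[X in _ + X + _](mulr0 2).
apply: mean_cvgD.
  by apply: mean_cvgD; [exact: mean_cvg_cst|exact: mean_cvgZ].
under eq_fun do under eq_fun do rewrite correctionE.
rewrite correctionE; apply: mean_cvgZ.
apply: mean_cvg_sum => r; apply: mean_cvg_sum => s; apply: mean_cvgZ.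
under eq_fun do under eq_fun do rewrite AvecE.
rewrite AvecE; apply: mean_cvgD.
  by apply: mean_cvgD; [exact: mean_cvg_cst|exact: mean_cvgZ].
apply: mean_cvg_sum => t; apply: mean_cvg_sum => u.
under eq_fun do under eq_fun do rewrite mulrAC.
by rewrite mulrAC; exact: mean_cvgZ.
Qed.

(** The same bounded [In] stands on both sides; only [F] and [Kn] are replaced by their limits in
    probability, and these replacements pass through sums and products. *)
Lemma peqv_leading (F : nat -> Om -> 'M[R]_p) (In : nat -> Om -> 'M[R]_p)
    (Kn : nat -> Om -> 'I_p -> 'I_p -> 'I_p -> R)
    (G : 'M[R]_p) (K : 'I_p -> 'I_p -> 'I_p -> R) (c : 'cV[R]_p)
    (J0 := fun _ _ _ : 'I_p => 0 : R) :
  (forall r s, op P (fun n w => F n w r s - G r s : R^o) (fun=> 1)) ->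
  (forall r s, Op P (fun n w => In n w r s : R^o) (fun=> 1)) ->
  (forall r s t, op P (fun n w => Kn n w r s t - K r s t : R^o) (fun=> 1)) ->
  forall v, peqv P
   (fun n w => (F n w *m (c + correction (F n w)
                               (Avec (F n w) (In n w) J0 (Kn n w)))) v 0)
   (fun n w => (G *m (c + correction G (Avec G (In n w) J0 K))) v 0).
Proof.
move=> oF OI oK v.
have eF r s := peqv_op (oF r s); have eK r s t := peqv_op (oK r s t).
under eq_fun do under eq_fun do rewrite mxE.
under [X in peqv _ _ X]eq_fun do under eq_fun do rewrite mxE.
apply: peqv_sum => j; apply: peqvM => //.
under eq_fun do under eq_fun do rewrite mxE correctionE.
under [X in peqv _ _ X]eq_fun do under eq_fun do rewrite mxE correctionE.
apply: peqvD; first exact: peqv_cst.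
apply: peqvM; first exact: peqv_cst.
apply: peqv_sum => r; apply: peqv_sum => s; apply: peqvM => //.
under eq_fun do under eq_fun do rewrite AvecE.
under [X in peqv _ _ X]eq_fun do under eq_fun do rewrite AvecE.
apply: peqvD; first by apply: peqvD => //; exact: peqv_cst.
apply: peqv_sum => t; apply: peqv_sum => u; apply: peqvM => //.
by apply: peqvM => //; exact: peqv_refl.
Qed.

End mean_leading_limit.

(** * Expectations as real-valued integrals *)

Section expectation.
Context {R : realType} {d : measure_display} {Om : measurableType d}
  (P : probability Om R).

Lemma expectation_mean_cvg (Y : nat -> Om -> R) (a : R) :
  (\forall n \near \oo, P.-integrable setT (fun w => (Y n w)%:E)) ->
  ('E_P[Y n] @[n --> \oo] --> a%:E)%E -> mean_cvg P Y a.
Proof.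
move=> iY /fine_cvg cY; split=> //.
by move: cY; rewrite unlock.
Qed.

Lemma vec_expectationE p (Y : Om -> 'cV[R]_p) v :
  vec_expectation P Y v 0 = \int[P]_w Y w v 0.
Proof. by rewrite mxE unlock. Qed.

End expectation.

(** * Asymptotic bias of the Bayes estimator *)

Theorem corollary2 (R : realType) (p : nat) (d d' : measure_display)
    (T : measurableType d) (Om : measurableType d')
    (P : probability Om R) (X : nat -> {RV P >-> T})
    (mu : forall n, {sigma_finite_measure set (n.-tuple T) -> \bar R})
    (f : forall n, 'cV[R]_p -> n.-tuple T -> R)
    (B : 'I_p -> interval R) (theta : 'cV[R]_p) (prior : 'cV[R]_p -> R)
    (thML : forall n, n.-tuple T -> 'cV[R]_p)
    (H I : 'M[R]_p) (J K : 'I_p -> 'I_p -> 'I_p -> R) :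
  let Theta := box B in
  let l := loglik X f in
  let thetaML n w := thML n (sample X n w) in
  let thetaB := bayes X f Theta prior in
  let rem := expansion_remainder X f Theta theta prior in
  let rate : nat -> R := fun n => n%:R^-1 in
  let root_rate : nat -> R := fun n => (Num.sqrt n%:R)^-1 in
  (* the model *)
  joint_density X mu f Theta theta ->
  Theta° theta ->
  (* the prior density *)
  (forall t, Theta t -> 0 <= prior t) -> 0 < prior theta ->
  (* the estimators *)
  (\forall n \near \oo, {ae P, forall w,
     Theta° (thetaML n w) /\ grad (l n w) (thetaML n w) = 0}) ->
  (\forall n \near \oo, {ae P, forall w,
     posterior_mean_exists X f Theta prior n w}) ->
  (forall n v, measurable_fun setT (fun w => thetaB n w v 0)) ->
  (* (i) *)
  Op P (fun n w => thetaML n w - theta) root_rate ->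
  (* (ii) *)
  Op P (fun n w => l n w theta : R^o) (fun n => n%:R) ->
  (* (iii) *)
  (\forall n \near \oo, {ae P, forall w,
     (forall t, Theta° t -> 0 < f n t (sample X n w)) /\
     Ck_on 3 Theta° (l n w)}) ->
  (* (iv) *)
  (forall t, Theta° t -> differentiable prior t) ->
  (* (v) *)
  (\forall n \near \oo, {ae P, forall w,
     Hn n (l n w) theta \in unitmx /\ posdef (Hn n (l n w) (thetaML n w))}) ->
  (* the expansion of the Bayes estimator *)
  op P rem rate ->
  (\forall n \near \oo, vec_integrable P (rem n)) ->
  (fun n => vec_expectation P (rem n)) =o_\oo rate ->
  (* regularity needed to take expectations in the expansion: the score has
     mean zero, and the error made in the leading term when H_n and K_n are
     replaced by their limits is uniformly integrable *)
  (\forall n \near \oo, vec_integrable P (fun w => grad (l n w) theta) /\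
     vec_expectation P (fun w => grad (l n w) theta) = 0) ->
  (forall v, asymptotically_uniformly_integrable P (fun n w =>
     (leading X f theta prior n w - leading_lim X f theta prior H K n w) v 0)) ->
  (* (a) *)
  H \in unitmx ->
  Op P (fun n w => Hn n (l n w) theta - H) root_rate ->
  (* (b) *)
  (forall r s t, op P (fun n w => (Kn n (l n w) theta r s t - K r s t) : R^o)
                      (fun=> 1)) ->
  (* (c) *)
  (forall r s,
     (\forall n \near \oo,
        P.-integrable setT (fun w => (In n (l n w) theta r s)%:E)) /\
     ('E_P[fun w => In n (l n w) theta r s] @[n --> \oo] --> (I r s)%:E)%E) ->
  (* (d) *)
  (forall r s t,
     (\forall n \near \oo,
        P.-integrable setT (fun w => (Jn n (l n w) theta r s t)%:E)) /\
     ('E_P[fun w => Jn n (l n w) theta r s t] @[n --> \oo] --> (J r s t)%:E)%E) ->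
  let A := Avec (invmx H) I J K in
  let dlogprior := grad (fun t => ln (prior t)) theta in
  [/\ Op P (fun n w => invmx (Hn n (l n w) theta) - invmx H) root_rate,
      \forall n \near \oo, vec_integrable P (thetaB n),
      (fun n => vec_expectation P (thetaB n) - theta
                - n%:R^-1 *: (invmx H *m (dlogprior + correction (invmx H) A)))
        =o_\oo rate &
      dlogprior = - correction (invmx H) A ->
      (fun n => vec_expectation P (thetaB n) - theta) =o_\oo rate].
Proof.
move=> Theta l thetaML thetaB rem rate root_rate _ Htheta _ prior0 _ _ mB _ _ Ck
  dprior unitHn _ irem orem Escore aui uH OH oK cI cJ A dlogprior.
pose S n w := grad (l n w) theta.
pose G := invmx H; pose F n w := invmx (Hn n (l n w) theta).
pose lead := leading X f theta prior.
pose lead_lim := leading_lim X f theta prior H K.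
have scoreE : \forall n \near \oo, {ae P, forall w,
    score_part X f theta prior n w = dlogprior + 2 *: S n w}.
  apply: filterS Ck => n; apply: filterS => w [_ [_ dl]].
  apply: grad_log_posterior => //; first exact/dprior.
  by move=> i; have [dli _] := dl i; exact: dli.
have root_ge0 n : 0 <= root_rate n by rewrite invr_ge0 sqrtr_ge0.
have OF : Op P (fun n w => F n w - G) root_rate.
  apply: (Op_invmx root_ge0 (root_rate_cvg0 (R := R)) uH _ OH).
  by apply: filterS unitHn => n; apply: filterS => w [].
have oF : op P (fun n w => F n w - G) (fun=> 1).
  by apply: (Op_op root_ge0) OF; exact: root_rate_cvg0.
have OF1 : Op P F (fun=> 1).
  have -> : F = fun n w => F n w - G + G.
    by apply/funext => n; apply/funext => w; rewrite subrK.
  by apply: OpD; [exact: op_Op|exact: Op_cst].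
have oFe r s : op P (fun n w => F n w r s - G r s : R^o) (fun=> 1).
  have := op_entry r s oF.
  by under eq_fun do under eq_fun do rewrite mxE [X in _ + X]mxE.
have remE n w v :
    rem n w v 0 = thetaB n w v 0 - theta v 0 - n%:R^-1 * lead n w v 0.
  exact: entry_subsub.
have mI r s : mean_cvg P (fun n w => In n (l n w) theta r s) (I r s).
  by have [] := cI r s; exact: expectation_mean_cvg.
have mJ r s t : mean_cvg P (fun n w => Jn n (l n w) theta r s t) (J r s t).
  by have [] := cJ r s t; exact: expectation_mean_cvg.
have InE n w r s : In n (l n w) theta r s = n%:R^-1 * (S n w r 0 * S n w s 0).
  by rewrite !mxE.
(* The diagonal entries of [In] are the normalised squared score components, so the order of the
   score follows from (c). *)
have [OS OI] : Op P S (fun n => Num.sqrt n%:R) /\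
    forall r s,
      Op P (fun n w => n%:R^-1 * (S n w r 0 * S n w s 0) : R^o) (fun=> 1).
  apply: score_Op (fun v => I v v) _ => v.
  by have := mI v v; under eq_fun do under eq_fun do rewrite InE.
have mS v : mean_cvg P (fun n w => S n w v 0) 0.
  split; first by apply: filterS Escore => n [iS _]; exact: iS.
  apply: cvg_near_cst; apply: filterS Escore => n [_ /colP/(_ v)].
  by rewrite vec_expectationE mxE.
have mD v : mean_cvg P (fun n w => (lead n w - lead_lim n w) v 0) 0.
  apply: aui_op_mean_cvg; first exact: aui.
  have OI' r s : Op P (fun n w => In n (l n w) theta r s : R^o) (fun=> 1).
    by under eq_fun do under eq_fun do rewrite InE; exact: OI.
  (* [o1] handles the part free of J and [oR] the quadratic term in H_n - H. By [leading_difference]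
     they add up to the difference of the leading terms almost surely, wherever H_n is invertible
     and the score decomposes. *)
  have [_ _ o1] := peqv_leading dlogprior oFe OI' oK v.
  have oR := op_entry v 0 (second_order_remainder G OF1 OH OS).
  apply: op_ae (opD o1 oR).
  apply: filterS2 scoreE unitHn => n; apply: filterS2 => w sE [uHn _].
  rewrite /lead /leading /lead_lim /leading_lim -/l sE leading_difference//.
  by rewrite [in RHS]mxE [in X in _ = X + _]mxE [in X in _ = _ + X + _]mxE.
have mL v : mean_cvg P (fun n w => lead n w v 0)
    ((G *m (dlogprior + correction G A)) v 0).
  have mLL := mean_cvg_leading_lim (Jn := fun n w => Jn n (l n w) theta)
    G K dlogprior mS mI mJ v.
  rewrite -[X in mean_cvg _ _ X]addr0.
  apply: mean_cvg_ae (mean_cvgD mLL (mD v)).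
    near=> n.
    have n0 : n%:R != 0 :> R.
      by rewrite pnatr_eq0 -lt0n; near: n; exact: nbhs_infty_gt.
    have ir : vec_integrable P (rem n) by near: n.
    (* Measurability of [lead] is obtained by solving the expansion for it in terms of the
       measurable [thetaB] and [rem], which requires n to be nonzero. *)
    have -> : (fun w => lead n w v 0) =
        (fun w => n%:R * (thetaB n w v 0 - theta v 0 - rem n w v 0)).
      by apply/funext => w; rewrite remE; field.
    apply: measurable_funM => //; apply: measurable_funB; last first.
      exact/measurable_EFinP/(measurable_int _ (ir v)).
    by apply: measurable_funB => //; exact: mB.
  apply: filterS scoreE => n; apply: filterS => w sE.
  rewrite [X in _ + X = _]mxE [X in _ + (_ + X) = _]mxE addrCA.
  by rewrite /lead_lim /leading_lim -/l sE subrr addr0.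
have EB : \forall n \near \oo, forall v,
    P.-integrable setT (EFin \o (fun w => thetaB n w v 0)) /\
    \int[P]_w thetaB n w v 0 =
      theta v 0 + n%:R^-1 * (\int[P]_w lead n w v 0) + \int[P]_w rem n w v 0.
  apply: filter_forall => v; have [iL _] := mL v.
  apply: filterS2 iL irem => n iL /(_ v) ir.
  have -> : (fun w => thetaB n w v 0) =
      (fun w => (theta v 0 + n%:R^-1 * lead n w v 0) + rem n w v 0).
    by apply/funext => w; rewrite remE; ring.
  have iZ := integrableZl measurableT n%:R^-1 iL.
  have ic := finite_measure_integrable_cst P (theta v 0) measurableT.
  have iD := integrableD measurableT ic iZ.
  have iB := integrableD measurableT iD ir.
  split; first exact: iB.
  rewrite RintegralD// RintegralD// RintegralZl// Rintegral_cst//.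
  rewrite [fine _](_ : _ = 1) ?mulr1//.
  exact: (congr1 fine (@probability_setT _ _ _ P)).
have main : (fun n => vec_expectation P (thetaB n) - theta
                - n%:R^-1 *: (invmx H *m (dlogprior + correction (invmx H) A)))
        =o_\oo rate.
  apply/eqoP => eps eps0.
  have e2 : 0 < eps / 2 by rewrite divr_gt0.
  move/eqoP : orem => /(_ _ e2) orem.
  have cL : \forall n \near \oo, forall v,
      `|(G *m (dlogprior + correction G A)) v 0 - \int[P]_w lead n w v 0| <=
      eps / 2.
    apply: filter_forall => v; have [_ /cvgrPdist_le] := mL v; exact.
  apply: filterS3 EB cL orem => n EB cL orem.
  apply: norm_le_entries => [|v j]; first by rewrite mulr_ge0// ltW.
  rewrite ord1 (splitr eps) mulrDl.
  have [_ EBv] := EB v; rewrite entry_subsub vec_expectationE EBv.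
  (* The bias error splits into 1/n times the error in the mean of [lead], plus the mean of the
     remainder; each part receives [eps / 2] times the rate. *)
  have -> (x y z u a : R) :
    x + a * y + z - x - a * u = - (a * (u - y)) + z by ring.
  apply: le_trans (ler_normD _ _) _; apply: lerD.
    by rewrite normrN normrM mulrC ler_wpM2r.
  by rewrite -vec_expectationE (le_trans (entry_le_norm _ _ _)).
split=> //.
  by apply: filterS EB => n EB v; have [iB _] := EB v; exact: iB.
move=> dE; move: main; rewrite dE addNr mulmx0.
by under eq_fun do rewrite scaler0 subr0.
Unshelve. all: by end_near. Qed.
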